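(* Let $m \ge 2$ and $n \ge 1$ be integers. Let $G$ be a graph with maximum degree $\Delta \ge 1$ whose vertex set admits a partition $V(G) = U_1 \cup U_2 \cup \dots \cup U_m$ into independent sets with $|U_i| \le n$ for all $i \in [m]$. Let $c$ be a locally $\left(\frac{n}{48\Delta^2}\right)$-bounded coloring of the complete balanced $m$-partite graph $K_{m\otimes n}$. Then $c$ is $G$-proper, i.e. the colored graph $K_{m\otimes n}$ contains a properly colored copy of $G$.
   Context: $K_{m\otimes n}$ denotes the complete $m$-partite graph with exactly $n$ vertices in each of its $m$ classes. A coloring of a graph $H$ is an arbitrary edge-coloring $c: E(H)\to\mathbb{N}$ (not necessarily proper). For a real number $k$, a coloring $c$ is locally $k$-bounded if each vertex of $H$ is incident to at most $k$ edges of any given color. A copy of $G$ in $H$ is a subgraph of $H$ isomorphic to $G$; it is properly colored if any two distinct edges of it sharing a vertex receive distinct colors. A coloring $c$ of $H$ is $G$-proper if $H$ contains a properly colored copy of $G$. *)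

(* Defs.v *)
From mathcomp Require Import all_boot all_order all_algebra.

Set Implicit Arguments.
Unset Strict Implicit.
Unset Printing Implicit Defensive.

Import Order.TTheory GRing.Theory Num.Theory.

Record sgraph := SGraph {
  vertex :> finType;
  adj : rel vertex;
  adj_sym : symmetric adj;
  adj_irrefl : irreflexive adj }.

Definition edges (G : sgraph) : {set {set G}} :=
  [set e : {set G} | [exists x, exists y, adj x y && (e == [set x; y])]].

Definition degree (G : sgraph) (x : G) : nat := #|[set y : G | adj x y]|.

Definition max_degree (G : sgraph) : nat := \max_(x : G) degree x.

Definition independent (G : sgraph) (A : {set G}) : Prop :=
  {in A &, forall x y : G, ~~ adj x y}.

(* The parts of an indexed partition may be empty. *)
Definition partition_family (T : finType) (m : nat) (U : 'I_m -> {set T}) :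
    Prop :=
  \bigcup_(i < m) U i = [set: T] /\
  (forall i j : 'I_m, i != j -> [disjoint U i & U j]).

Definition multipartite_adj (m n : nat) : rel ('I_m * 'I_n)%type :=
  fun u v => u.1 != v.1.

Lemma multipartite_adj_sym m n : symmetric (@multipartite_adj m n).
Proof. by move=> u v; rewrite /multipartite_adj eq_sym. Qed.

Lemma multipartite_adj_irrefl m n : irreflexive (@multipartite_adj m n).
Proof. by move=> u; rewrite /multipartite_adj eqxx. Qed.

(* The vertex (i, j) is the j-th vertex of the i-th class. *)
Definition complete_multipartite (m n : nat) : sgraph :=
  SGraph (@multipartite_adj_sym m n) (@multipartite_adj_irrefl m n).

(* Colorings are total on sets of vertices; every definition below only uses
   their values on edges. *)
Definition coloring (H : sgraph) : Type := {set H} -> nat.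

Definition locally_bounded (R : realFieldType) (k : R) (H : sgraph)
    (c : coloring H) : Prop :=
  forall (v : H) (a : nat),
    (#|[set e in edges H | (v \in e) && (c e == a)]|%:R <= k)%R.

Record subgraph (H : sgraph) := Subgraph {
  sub_vertices : {set H};
  sub_edges : {set {set H}};
  sub_edges_edges : sub_edges \subset edges H;
  sub_edges_ends : forall e, e \in sub_edges -> e \subset sub_vertices }.

(* The subgraph S of H is isomorphic to G. *)
Definition is_copy (G H : sgraph) (S : subgraph H) : Prop :=
  exists f : G -> H,
    [/\ injective f,
        f @: [set: G] = sub_vertices S &
        forall x y : G, adj x y = ([set f x; f y] \in sub_edges S)].

Definition properly_colored (H : sgraph) (c : coloring H) (S : subgraph H) :
    Prop :=
  {in sub_edges S &, forall e1 e2 : {set H},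
     e1 != e2 -> e1 :&: e2 != set0 -> c e1 <> c e2}.

Definition proper_for (G H : sgraph) (c : coloring H) : Prop :=
  exists S : subgraph H, is_copy G S /\ properly_colored c S.

(* Main.v *)
(* Embed [G] by a random class-preserving injection [f].  A bad event says that
   [f] sends a cherry (x; y, z) of [G] to given vertices a, b, c such that ab
   and ac have the same color.  Two events interact when they share a vertex of
   [G] or of the host graph.  Transporting the image of one event by
   permutations of the host gives the negative dependence needed for the
   lopsided Lovasz local lemma: conditioned on avoiding events that do not
   interact with it, an event has probability at most 1 / (n^2 (n - 1)).  With
   K = n / (48 Delta^2), each event interacts with at most 9 Delta^2 n^2 K
   others, so their total probability is at most 1/4. *)

Require Import Defs.
From mathcomp Require Import all_boot all_order all_algebra all_fingroup.
From mathcomp Require Import zify.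

Set Implicit Arguments.
Unset Strict Implicit.
Unset Printing Implicit Defensive.

(** * Counting *)

Lemma leq_card_inj (S T : finType) (A : {set S}) (B : {set T}) (g : S -> T) :
  {in A &, injective g} -> {in A, forall u, g u \in B} -> #|A| <= #|B|.
Proof.
move=> g_inj gAB; rewrite -(card_in_imset g_inj).
by apply/subset_leq_card/subsetP => _ /imsetP[u uA ->]; apply: gAB.
Qed.

Lemma leq_card_fibers (S T : finType) (A : {set S}) (B : {set T}) (g : S -> T)
    (k l : nat) :
    {in A, forall u, g u \in B} -> #|B| <= k ->
    (forall p, p \in B -> #|[set u in A | g u == p]| <= l) ->
  #|A| <= k * l.
Proof.
move=> gAB leBk fibers; apply: leq_trans (_ : #|B| * l <= _); last first.
  by rewrite leq_mul2r leBk orbT.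
rewrite -sum1_card (partition_big g (mem B)) //= -sum_nat_const.
apply: leq_sum => p pB; apply: leq_trans (fibers p pB).
by rewrite sum1dep_card.
Qed.

Lemma leq_card_bigcup (I T : finType) (A : {set I}) (F : I -> {set T}) :
  #|\bigcup_(i in A) F i| <= \sum_(i in A) #|F i|.
Proof.
elim/big_rec2: _ => [|i s B _ IH]; first by rewrite cards0.
by apply: leq_trans (leq_card_setU _ _) _; rewrite leq_add2l.
Qed.

(** * The lopsided local lemma *)

Section LopsidedLocalLemma.

Variables (T I : finType) (Omega : {set T}) (holds : I -> pred T).
Variables (B : {set I}) (conf : rel I) (N : nat).

(** Probability is uniform on [Omega], so conditional probabilities are ratios of cardinalities, and
    all bounds are stated in [nat] with denominators cleared. *)
Definition avoiding (S : {set I}) : {set T} :=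
  [set f in Omega | [forall e in S, ~~ holds e f]].

Lemma avoidingS (S1 S2 : {set I}) :
  S1 \subset S2 -> avoiding S2 \subset avoiding S1.
Proof.
move=> /subsetP sub; apply/subsetP => f; rewrite !inE.
by move=> /andP[-> /= /forall_inP h]; apply/forall_inP => e /sub; apply: h.
Qed.

Lemma avoidingU (S1 S2 : {set I}) :
  avoiding S1 :\: avoiding (S1 :|: S2)
    \subset \bigcup_(e in S2) [set f in avoiding S1 | holds e f].
Proof.
apply/subsetP => f; rewrite inE => /andP[fN fS1].
move: (fS1) fN; rewrite !inE => /andP[-> /= /forall_inP h1].
rewrite negb_forall_in => /exists_inP[e]; rewrite inE negbK => eS he.
case/orP: eS => [eS1|eS2]; first by move: (h1 e eS1); rewrite he.
by apply/bigcupP; exists e; rewrite // inE fS1.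
Qed.

Lemma card_avoidingU (S1 S2 : {set I}) :
  #|avoiding S1| <= #|avoiding (S1 :|: S2)|
     + \sum_(e in S2) #|[set f in avoiding S1 | holds e f]|.
Proof.
rewrite -(cardsID (avoiding (S1 :|: S2)) (avoiding S1)) leq_add //.
  by apply/subset_leq_card/subsetIr.
exact: leq_trans (subset_leq_card (avoidingU S1 S2)) (leq_card_bigcup _ _).
Qed.

(** With p = 1/[N], this one-sided bound replaces independence, and [conf_bound] is the symmetric
    condition 4pd <= 1. *)
Hypothesis nonconf_bound : forall (e : I) (S : {set I}),
  e \in B -> S \subset B -> {in S, forall e', ~~ conf e e'} ->
  N * #|[set f in avoiding S | holds e f]| <= #|avoiding S|.
Hypothesis conf_bound : forall e,
  e \in B -> 4 * #|[set e' in B | conf e e']| <= N.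

(* By induction on [S]: conditioning on the events of [S] that conflict with
   [e] shrinks the sample space by a factor of at most 2. *)
Lemma conditional_bound (S : {set I}) (e : I) :
  S \subset B -> e \in B ->
  N * #|[set f in avoiding S | holds e f]| <= 2 * #|avoiding S|.
Proof.
have [k] := ubnP #|S|; elim: k S e => // k IH S e ltSk SB eB.
pose S1 := [set e' in S | conf e e']; pose S2 := [set e' in S | ~~ conf e e'].
have defS : S = S2 :|: S1.
  by apply/setP => x; rewrite !inE -andb_orr orNb andbT.
have S2S : S2 \subset S by apply/subsetP => x; rewrite inE => /andP[].
have S2B := subset_trans S2S SB.
have S1B : S1 \subset [set e' in B | conf e e'].
  by apply/subsetP => x; rewrite !inE => /andP[/(subsetP SB) -> ->].
have leN : N * #|[set f in avoiding S | holds e f]| <= #|avoiding S2|.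
  apply: leq_trans (nonconf_bound eB S2B _); last first.
    by move=> x; rewrite inE => /andP[].
  rewrite leq_mul2l; apply/orP; right; apply/subset_leq_card/subsetP => f.
  rewrite inE => /andP[fS ef]; rewrite inE ef andbT.
  exact: (subsetP (avoidingS S2S)).
apply: leq_trans leN _.
have [S10|[e0 e0S1]] := set_0Vmem S1.
  by rewrite defS S10 setU0 mul2n -addnn leq_addr.
(* [S2] misses [e0], so the induction hypothesis applies with [S2] as the conditioning set. *)
have ltS2k : #|S2| < k.
  rewrite -ltnS; apply: leq_trans ltSk; rewrite ltnS; apply: proper_card.
  apply/properP; split=> //; exists e0; move: e0S1; rewrite !inE.
    by case/andP.
  by case/andP => _ ->; rewrite andbF.
have sumS1 : N * \sum_(e' in S1) #|[set f in avoiding S2 | holds e' f]|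
               <= #|S1| * (2 * #|avoiding S2|).
  rewrite big_distrr -sum_nat_const; apply: leq_sum => e' e'S1.
  apply: IH => //; apply: (subsetP SB).
  by move: e'S1; rewrite inE => /andP[].
have := card_avoidingU S2 S1; rewrite -defS => split_S.
have leS1 : 4 * #|S1| <= N.
  by apply: leq_trans (conf_bound eB); rewrite leq_mul // subset_leq_card.
have N_gt0 : 0 < N.
  by apply: leq_trans leS1; rewrite muln_gt0 /=; apply/card_gt0P; exists e0.
move: sumS1 split_S leS1; set s := \sum_(_ in _) _.
set a := #|avoiding S2|; set b := #|avoiding S|; set u := #|S1|.
(* From [N * s <= 2 * u * a] and [4 * u <= N] follows [2 * s <= a]; with [a <= b + s] this gives
   [a <= 2 * b]. *)
move=> h1 h2 h3; rewrite -(leq_pmul2l N_gt0); nia.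
Qed.

(** Avoiding one more event loses at most a fraction 2/[N] of the points, which is less than all of
    them since [N > 2]. *)
Lemma lopsided_local_lemma :
  2 < N -> Omega != set0 -> avoiding B != set0.
Proof.
move=> N_gt2 Omega0.
suff H (S : {set I}) : S \subset B -> 0 < #|avoiding S|.
  by rewrite -card_gt0; apply: H.
have [k] := ubnP #|S|; elim: k S => // k IH S ltSk SB.
have [->|[e eS]] := set_0Vmem S.
  rewrite (_ : avoiding set0 = Omega) ?card_gt0 //.
  apply/setP => f; rewrite inE; case: (f \in Omega) => //=.
  by apply/forall_inP => x; rewrite inE.
have eB := subsetP SB _ eS.
have S'B : S :\ e \subset B by apply: subset_trans SB; apply: subsetDl.
have ltS' : #|S :\ e| < k by move: ltSk; rewrite (cardsD1 e S) eS.
have := card_avoidingU (S :\ e) [set e]; rewrite big_set1 setUC setD1K // => h1.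
have h2 := conditional_bound S'B eB; have h3 := IH _ ltS' S'B.
move: h1 h2 h3; set a := #|avoiding (S :\ e)|; nia.
Qed.

End LopsidedLocalLemma.

(** * Permutations transporting one sequence to another *)

(* When [s] and [t] are duplicate-free of equal size, a permutation sending
   [s] to [t] pointwise that moves a point outside [s] only into [s]. *)
Fixpoint transporter (T : finType) (s t : seq T) : {perm T} :=
  if s is a :: s' then if t is b :: t' then
    (transporter s' t' * tperm (transporter s' t' a) b)%g else 1%g else 1%g.

(** An image that hits [b] is redirected to the image of [a], which lies in [a :: s] by induction.
    This keeps a transport from creating events: a vertex outside the cherry whose image changes
    lands on an old target of the cherry. *)
Lemma transporter_outside (T : finType) (s t : seq T) (p : T) :
  uniq s -> p \notin s -> transporter s t p \in p :: s.
Proof.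
elim: s t p => [|a s IH] [|b t] p /=; rewrite ?perm1 ?mem_head //.
case/andP => a_s s_uniq; rewrite inE negb_or => /andP[pa ps].
have tau_a := IH t a s_uniq a_s.
rewrite permM; case: tpermP => [/perm_inj p_a|_|_ _].
- by rewrite p_a eqxx in pa.
- by rewrite inE tau_a orbT.
- by move: (IH t p s_uniq ps); rewrite !inE => /orP[]->; rewrite ?orbT.
Qed.

Lemma transporter_map (T : finType) (s t : seq T) :
  uniq s -> uniq t -> size s = size t -> map (transporter s t) s = t.
Proof.
elim: s t => [|a s IH] [|b t] //= /andP[a_s s_uniq] /andP[b_t t_uniq] [eq_st].
rewrite permM tpermL; congr cons.
rewrite -[RHS](IH t) //; apply/eq_in_map => p ps.
rewrite permM tpermD //.
  by apply: contraNneq a_s => /perm_inj ->.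
by apply: contraNneq b_t => ->; have:= map_f (transporter s t) ps; rewrite IH.
Qed.

(** Each transposition exchanges two points of equal [h]-value. With [h] the class index,
    transported embeddings still respect the classes. *)
Lemma transporter_invariant (T : finType) (S : eqType) (h : T -> S)
    (s t : seq T) (p : T) :
  map h s = map h t -> h (transporter s t p) = h p.
Proof.
elim: s t p => [|a s IH] [|b t] p //=; rewrite ?perm1 // => -[h_ab h_st].
rewrite permM; case: tpermP => [E|E|_ _]; rewrite ?IH //.
  by rewrite -h_ab -(IH t a) // -E IH.
by rewrite h_ab -E IH.
Qed.

(** * Injections without monochromatic cherries *)

Definition seq3 (T : Type) (p : T * T * T) : seq T :=
  [:: p.1.1; p.1.2; p.2].

(** The default [p.2] makes every index from 2 on read the third entry, so the counts below hold for
    all [nat] indices. *)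
Definition nth3 (T : Type) (i : nat) (p : T * T * T) : T :=
  nth p.2 (seq3 p) i.

Lemma mem_seq3 (T : eqType) (v : T) (p : T * T * T) :
  v \in seq3 p -> exists i : 'I_3, nth3 i p = v.
Proof.
by rewrite !inE => /or3P[]/eqP->;
  [exists ord0 | exists (inord 1) | exists (inord 2)];
  rewrite // /nth3 inordK.
Qed.

Lemma card_class (m n : nat) (i : 'I_m) :
  #|[set b : 'I_m * 'I_n | b.1 == i]| <= n.
Proof.
have: #|[set: 'I_n]| <= n by rewrite cardsT card_ord.
apply: leq_trans; apply: (leq_card_inj (g := snd)) => [[i1 j1] [i2 j2]|//].
by rewrite !inE /= => /eqP-> /eqP-> ->.
Qed.

Section CherryAvoidance.

Variables (m n D K : nat) (G : sgraph) (cl : G -> 'I_m).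
Local Notation H := ('I_m * 'I_n)%type.
Variable col : H -> H -> nat.

Hypothesis adj_cl : forall x y : G, adj x y -> cl x != cl y.
Hypothesis card_cl : forall i, #|[set x | cl x == i]| <= n.
Hypothesis degree_le : forall x : G, degree x <= D.
Hypothesis col_le : forall a b : H,
  #|[set b' : H | (b'.1 != a.1) && (col a b' == col a b)]| <= K.

Definition cherry (s : G * G * G) : bool :=
  [&& adj s.1.1 s.1.2, adj s.1.1 s.2 & s.1.2 != s.2].

Definition bad_target (s : G * G * G) (t : H * H * H) : bool :=
  [&& t.1.1.1 == cl s.1.1, t.1.2.1 == cl s.1.2, t.2.1 == cl s.2,
      t.1.2 != t.2 & col t.1.1 t.1.2 == col t.1.1 t.2].

Local Notation event := ((G * G * G) * (H * H * H))%type.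

Definition bad_events : {set event} :=
  [set e | cherry e.1 && bad_target e.1 e.2].

(* Each cherry is listed with only one of the two orders of its leaves: this
   factor 2 is needed for the constant 48. *)
Definition oriented_events : {set event} :=
  [set e in bad_events | enum_rank e.1.1.2 < enum_rank e.1.2].

Definition event_holds (e : event) : pred {ffun G -> H} :=
  fun f : {ffun G -> H} => map f (seq3 e.1) == seq3 e.2.

Definition meets (e e' : event) : bool :=
  [exists ij : 'I_3 * 'I_3, (nth3 ij.2 e'.1 == nth3 ij.1 e.1)
                         || (nth3 ij.2 e'.2 == nth3 ij.1 e.2)].

Definition class_injections : {set {ffun G -> H}} :=
  [set f : {ffun G -> H} | injectiveb f && [forall x, (f x).1 == cl x]].

(** * Counting the bad events that meet a given event *)

Lemma bad_target_cl (s : G * G * G) (t : H * H * H) (j : nat) :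
  bad_target s t -> (nth3 j t).1 = cl (nth3 j s).
Proof.
case/and5P => /eqP t1 /eqP t2 /eqP t3 _ _.
by case: j => [|[|[|j]]] //; rewrite /nth3 /= !nth_default.
Qed.

(** Whichever vertex is fixed, the other two are reached along two edges of [G], with at most [D]
    choices each. *)
Lemma card_cherry_at (j : nat) (v : G) :
  #|[set s | cherry s & nth3 j s == v]| <= D * D.
Proof.
wlog lt_j2 : j / j < 3 => [wlog_j|].
  have [/wlog_j //|le2j] := ltnP j 3.
  apply: leq_trans (wlog_j 2 _) => //; apply/subset_leq_card/subsetP => s.
  by rewrite !inE /nth3 nth_default.
case: j lt_j2 => [|[|[|//]]] _.
- apply: (leq_card_fibers (g := fun s => s.1.2)
            (B := [set y : G | adj v y]) _ (degree_le v)).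
  + by move=> [[x y] z]; rewrite !inE => /andP[/and3P[/= vy _ _] /eqP <-].
  + move=> p _; apply: leq_trans (degree_le v).
    apply: (leq_card_inj (g := fun s => s.2)).
      move=> [[x y] z] [[x' y'] z']; rewrite !inE /nth3 /=.
      by move=> /andP[/andP[_ /eqP->] /eqP->] /andP[/andP[_ /eqP->] /eqP->] ->.
    move=> [[x y] z]; rewrite !inE /nth3 /=.
    by move=> /andP[/andP[/and3P[_ /= vz _] /eqP<-] _].
- apply: (leq_card_fibers (g := fun s => s.1.1)
            (B := [set x : G | adj v x]) _ (degree_le v)).
  + move=> [[x y] z]; rewrite !inE /nth3 => /andP[/and3P[/= xy _ _] /eqP <-].
    by rewrite adj_sym.
  + move=> p _; apply: leq_trans (degree_le p).
    apply: (leq_card_inj (g := fun s => s.2)).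
      move=> [[x y] z] [[x' y'] z']; rewrite !inE /nth3 /=.
      by move=> /andP[/andP[_ /eqP->] /eqP->] /andP[/andP[_ /eqP->] /eqP->] ->.
    move=> [[x y] z]; rewrite !inE /nth3 /=.
    by move=> /andP[/andP[/and3P[_ /= xz _] _] /eqP<-].
- apply: (leq_card_fibers (g := fun s => s.1.1)
            (B := [set x : G | adj v x]) _ (degree_le v)).
  + move=> [[x y] z]; rewrite !inE /nth3 => /andP[/and3P[/= _ xz _] /eqP <-].
    by rewrite adj_sym.
  + move=> p _; apply: leq_trans (degree_le p).
    apply: (leq_card_inj (g := fun s => s.1.2)).
      move=> [[x y] z] [[x' y'] z']; rewrite !inE /nth3 /=.
      by move=> /andP[/andP[_ /eqP->] /eqP->] /andP[/andP[_ /eqP->] /eqP->] ->.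
    move=> [[x y] z]; rewrite !inE /nth3 /=.
    by move=> /andP[/andP[/and3P[/= xy _ _] _] /eqP<-].
Qed.

Lemma card_cherry_class (j : nat) (i : 'I_m) :
  #|[set s | cherry s & cl (nth3 j s) == i]| <= n * (D * D).
Proof.
apply: (leq_card_fibers (g := nth3 j) _ (card_cl i)) => [s|p].
  by rewrite !inE => /andP[].
move=> _; apply: leq_trans (card_cherry_at j p).
apply/subset_leq_card/subsetP => s; rewrite !inE.
by move=> /andP[/andP[-> _] ->].
Qed.

(** A second vertex (the center, or a leaf if the center is fixed) has [n] choices in its class. The
    remaining leaf must repeat a known color at the center, which leaves at most [K] choices. *)
Lemma card_bad_target_at (s : G * G * G) (j : nat) (t : H) :
  cherry s -> #|[set p | bad_target s p & nth3 j p == t]| <= n * K.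
Proof.
move=> /and3P[/adj_cl xy /adj_cl xz _].
wlog lt_j2 : j / j < 3 => [wlog_j|].
  have [/wlog_j //|le2j] := ltnP j 3.
  apply: leq_trans (wlog_j 2 _) => //; apply/subset_leq_card/subsetP => p.
  by rewrite !inE /nth3 nth_default.
case: j lt_j2 => [|[|[|//]]] _.
- apply: (leq_card_fibers (g := fun p => p.1.2) _ (card_class n (cl s.1.2))).
    by move=> [[a b] d]; rewrite !inE => /andP[/and5P[]].
  move=> b0 _; apply: leq_trans (col_le t b0).
  apply: (leq_card_inj (g := fun p => p.2)).
    move=> [[a b] d] [[a' b'] d']; rewrite !inE /nth3 /=.
    by move=> /andP[/andP[_ /eqP->] /eqP->] /andP[/andP[_ /eqP->] /eqP->] ->.
  move=> [[a b] d]; rewrite !inE /nth3 /=.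
  move=> /andP[/andP[/and5P[/= ax _ dz _ ab] /eqP<-] /eqP<-].
  by rewrite (eqP ax) (eqP dz) eq_sym xz eq_sym.
- apply: (leq_card_fibers (g := fun p => p.1.1) _ (card_class n (cl s.1.1))).
    by move=> [[a b] d]; rewrite !inE => /andP[/and5P[]].
  move=> a0 _; apply: leq_trans (col_le a0 t).
  apply: (leq_card_inj (g := fun p => p.2)).
    move=> [[a b] d] [[a' b'] d']; rewrite !inE /nth3 /=.
    by move=> /andP[/andP[_ /eqP->] /eqP->] /andP[/andP[_ /eqP->] /eqP->] ->.
  move=> [[a b] d]; rewrite !inE /nth3 /=.
  move=> /andP[/andP[/and5P[/= ax _ dz _ ab] /eqP<-] /eqP<-].
  by rewrite (eqP ax) (eqP dz) eq_sym xz eq_sym.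
- apply: (leq_card_fibers (g := fun p => p.1.1) _ (card_class n (cl s.1.1))).
    by move=> [[a b] d]; rewrite !inE => /andP[/and5P[]].
  move=> a0 _; apply: leq_trans (col_le a0 t).
  apply: (leq_card_inj (g := fun p => p.1.2)).
    move=> [[a b] d] [[a' b'] d']; rewrite !inE /nth3 /=.
    by move=> /andP[/andP[_ /eqP->] /eqP->] /andP[/andP[_ /eqP->] /eqP->] ->.
  move=> [[a b] d]; rewrite !inE /nth3 /=.
  move=> /andP[/andP[/and5P[/= ax yb _ _ ab] /eqP<-] /eqP<-].
  by rewrite (eqP ax) (eqP yb) eq_sym xy.
Qed.

Lemma card_bad_target (s : G * G * G) :
  cherry s -> #|[set p | bad_target s p]| <= n * (n * K).
Proof.
move=> s_cherry.
apply: (leq_card_fibers (g := nth3 0) _ (card_class n (cl s.1.1))) => [p|t _].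
  by rewrite !inE => /and5P[].
apply: leq_trans (card_bad_target_at 0 t s_cherry).
by apply/subset_leq_card/subsetP => p; rewrite !inE.
Qed.

Lemma card_bad_events_source (j : nat) (v : G) :
  #|[set e in bad_events | nth3 j e.1 == v]| <= D * D * (n * (n * K)).
Proof.
apply: (leq_card_fibers (g := fst) _ (card_cherry_at j v)) => [e|s].
  by rewrite !inE => /andP[/andP[-> _] ->].
rewrite inE => /andP[s_cherry _]; apply: leq_trans (card_bad_target s_cherry).
apply: (leq_card_inj (g := snd)) => [[s1 t1] [s2 t2]|[s1 t1]]; rewrite !inE /=.
  by move=> /andP[_ /eqP->] /andP[_ /eqP->] ->.
by move=> /andP[/andP[/andP[_ ?] _] /eqP<-].
Qed.

(** The class of [t] determines that of the [j]-th source vertex, which leaves at most [n * D^2]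
    cherries, each with at most [n * K] placements through [t]. *)
Lemma card_bad_events_target (j : nat) (t : H) :
  #|[set e in bad_events | nth3 j e.2 == t]| <= n * (D * D) * (n * K).
Proof.
apply: (leq_card_fibers (g := fst) _ (card_cherry_class j t.1)) => [e|s].
  rewrite !inE => /andP[/andP[-> e_bad] /eqP<-].
  by rewrite (bad_target_cl j e_bad) eqxx.
rewrite inE => /andP[s_cherry _].
apply: leq_trans (card_bad_target_at j t s_cherry).
apply: (leq_card_inj (g := snd)) => [[s1 t1] [s2 t2]|[s1 t1]]; rewrite !inE /=.
  by move=> /andP[_ /eqP->] /andP[_ /eqP->] ->.
by move=> /andP[/andP[/andP[_ st1] t1j] /eqP<-]; rewrite st1.
Qed.

Lemma card_meets (e : event) :
  #|[set e' in bad_events | meets e e']| <= 18 * (D * D * (n * (n * K))).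
Proof.
(* Nine pairs of indices, each for a shared source vertex and for a shared target vertex, give the
   factor 18. *)
pose X (ij : 'I_3 * 'I_3) :=
  [set e' in bad_events | nth3 ij.2 e'.1 == nth3 ij.1 e.1]
  :|: [set e' in bad_events | nth3 ij.2 e'.2 == nth3 ij.1 e.2].
apply: leq_trans (_ : #|\bigcup_(ij in setT) X ij| <= _).
  apply/subset_leq_card/subsetP => e'; rewrite inE => /andP[e'_bad].
  case/existsP => ij e'_meets; apply/bigcupP; exists ij; rewrite // in_setU.
  by case/orP: e'_meets => e'_meets; apply/orP; [left|right];
    rewrite inE e'_bad.
apply: leq_trans (leq_card_bigcup _ _) _.
apply: leq_trans (_ : \sum_(ij in [set: 'I_3 * 'I_3])
                        (2 * (D * D * (n * (n * K)))) <= _).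
  apply: leq_sum => ij _; apply: leq_trans (leq_card_setU _ _) _.
  rewrite mul2n -addnn leq_add ?card_bad_events_source //.
  apply: leq_trans (card_bad_events_target _ _) _.
  by rewrite (mulnC n (D * D)) -!mulnA.
by rewrite sum_nat_const cardsT card_prod !card_ord mulnA.
Qed.

Definition swap_leaves (T : Type) (p : T * T * T) : T * T * T :=
  (p.1.1, p.2, p.1.2).

Definition swap_event (e : event) : event :=
  (swap_leaves e.1, swap_leaves e.2).

Lemma swap_bad_events (e : event) :
  e \in bad_events -> swap_event e \in bad_events.
Proof.
case: e => [[[x y] z] [[a b] d]]; rewrite !inE /cherry /bad_target /=.
case/andP => /and3P[-> -> yz] /and5P[-> -> -> bd /eqP->].
by rewrite eqxx (eq_sym z) yz (eq_sym d) bd.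
Qed.

Lemma meets_swap (e e' : event) : meets e e' -> meets e (swap_event e').
Proof.
case/existsP => -[i j] /= e_meets; apply/existsP.
exists (i, tperm (inord 1) (inord 2) j).
have swap_nth (T : Type) (p : T * T * T) :
    nth3 (tperm (inord 1) (inord 2) j) (swap_leaves p) = nth3 j p.
  case: tpermP => [->|->|/eqP j1 /eqP j2]; rewrite /nth3 ?inordK //.
  have -> : j = ord0.
    move: j1 j2; rewrite -!val_eqE /= !inordK //.
    by case: j {e_meets} => [[|[|[|]]] lt_j] //= _ _; apply: val_inj.
  by [].
by rewrite /= !swap_nth.
Qed.

(** Swapping leaves sends the oriented events meeting [e] injectively to bad events of the opposite
    orientation that still meet [e]; the two families are disjoint. *)
Lemma card_meets_oriented (e : event) :
  2 * #|[set e' in oriented_events | meets e e']|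
    <= 18 * (D * D * (n * (n * K))).
Proof.
apply: leq_trans (card_meets e); set A := [set _ in oriented_events | _].
have swap_inj : injective swap_event.
  move=> [[[x y] z] [[a b] d]] [[[x' y'] z'] [[a' b'] d']].
  by move=> [-> -> -> -> -> ->].
rewrite mul2n -addnn -{2}(card_imset A swap_inj) -cardsUI.
have -> : A :&: swap_event @: A = set0.
  apply/setP => e'; rewrite !inE; apply/negP => /andP[/andP[/andP[_ lt1] _]].
  move=> /imsetP[e2]; rewrite !inE => /andP[/andP[_ lt2] _] e'E.
  by move: lt1 lt2; rewrite e'E /= => /ltn_trans lt1 /lt1; rewrite ltnn.
have AE x : x \in A -> x \in bad_events /\ meets e x.
  by rewrite /A in_set /oriented_events in_set => /andP[/andP[]].
rewrite cards0 addn0; apply/subset_leq_card/subsetP => e'.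
case/setUP => [/AE[e'_bad e'_meets]|/imsetP[e2 /AE[e2_bad e2_meets] ->]].
  by rewrite in_set e'_bad.
by rewrite in_set swap_bad_events ?meets_swap.
Qed.

(** * Negative dependence by transport of placements *)

Lemma uniq_seq3_target (s : G * G * G) (t : H * H * H) :
    cherry s -> (forall j, (nth3 j t).1 = cl (nth3 j s)) -> t.1.2 != t.2 ->
  uniq (seq3 t).
Proof.
move=> /and3P[/adj_cl xy /adj_cl xz _] t_cl bd.
(* Only the leaves could share a class; the center lies in another class than each of them. *)
rewrite /= !inE negb_or bd !andbT.
have := t_cl 0; have := t_cl 1; have := t_cl 2; rewrite /nth3 /= => dz yb ax.
apply/andP; split; apply/eqP => E.
  by move: xy; rewrite -ax -yb E eqxx.
by move: xz; rewrite -ax -dz E eqxx.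
Qed.

(** Positions inside their classes for the center and the two leaves. Asking for distinct leaf
    positions even when the leaves lie in different classes makes the number of placements the same
    for every cherry. *)
Definition event_triples : {set 'I_n * ('I_n * 'I_n)} :=
  [set u | u.2.1 != u.2.2].

Lemma card_event_triples : #|event_triples| = n * (n * n.-1).
Proof.
have -> : event_triples = setX setT [set w : 'I_n * 'I_n | w.1 != w.2].
  by apply/setP => -[i w]; rewrite !inE.
rewrite cardsX cardsT card_ord; congr (_ * _).
rewrite -sum1dep_card.
rewrite -(pair_big_dep predT (fun i j => i != j) (fun _ _ => 1)) /=.
rewrite (eq_bigr (fun=> n.-1)) => [|i _].
  by rewrite sum_nat_const card_ord.
have := cardsC1 i; rewrite card_ord => <-; rewrite sum1dep_card.
by apply: eq_card => j; rewrite !inE eq_sym.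
Qed.

(* Composing with a transporter moves an embedding satisfying [e] to one
   satisfying any other admissible placement of the same cherry, without
   creating an event of [S]. *)
Lemma transport_bound (e : event) (S : {set event}) :
    e \in oriented_events -> S \subset oriented_events ->
    {in S, forall e', ~~ meets e e'} ->
  n * (n * n.-1) * #|[set f in avoiding class_injections event_holds S
                        | event_holds e f]|
    <= #|avoiding class_injections event_holds S|.
Proof.
rewrite !inE => /andP[/andP[]] e_cherry e_bad _ _ S_free.
set A := [set f in _ | _].
pose tgt (u : 'I_n * ('I_n * 'I_n)) : H * H * H :=
  ((cl e.1.1.1, u.1), (cl e.1.1.2, u.2.1), (cl e.1.2, u.2.2)).
pose tau u := transporter (seq3 e.2) (seq3 (tgt u)).
have uniq_e2 : uniq (seq3 e.2).
  apply: uniq_seq3_target e_cherry _ _ => [j|]; first exact: bad_target_cl.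
  by case/and5P: e_bad.
have uniq_tgt u : u \in event_triples -> uniq (seq3 (tgt u)).
  rewrite inE => u_ne; apply: uniq_seq3_target e_cherry _ _ => [j|].
    by case: j => [|[|[|j]]] //; rewrite /nth3 /= !nth_default.
  by apply: contraNneq u_ne => -[_ ->].
have tau_cl u p : (tau u p).1 = p.1.
  apply: transporter_invariant; rewrite /=.
  by case/and5P: e_bad => /eqP-> /eqP-> /eqP->.
pose push (w : ('I_n * ('I_n * 'I_n)) * {ffun G -> H}) :=
  [ffun x => tau w.1 (w.2 x)].
rewrite -card_event_triples -cardsX; apply: (leq_card_inj (g := push)).
  (* The transported map shows [u] on the vertices of the cherry; then [f] is recovered by inverting
     the permutation [tau u]. *)
  move=> [u f] [u' f']; rewrite !inE /= => /andP[u_ne /andP[_ ef]].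
  move=> /andP[u'_ne /andP[_ ef']] /ffunP eq_push.
  have push_e v g (v_ne : v.2.1 != v.2.2) (eg : event_holds e g) :
      map (push (v, g)) (seq3 e.1) = seq3 (tgt v).
    have <- : map (tau v) (seq3 e.2) = seq3 (tgt v).
      by apply: transporter_map; rewrite ?uniq_tgt ?inE.
    by rewrite -(eqP eg) -map_comp; apply: eq_map => x; rewrite ffunE.
  have eq_u : u = u'.
    have := push_e _ _ u_ne ef; rewrite (eq_map eq_push) push_e //.
    by case: u u' {u_ne u'_ne eq_push} => [i [j k]] [i' [j' k']] /= [-> -> ->].
  rewrite -eq_u in eq_push *; congr pair; apply/ffunP => x.
  by move: (eq_push x); rewrite !ffunE => /perm_inj.
move=> [u f]; rewrite !inE /=.
case/and3P => u_ne + ef.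
case/andP => /andP[/injectiveP f_inj /forallP f_cl] /forall_inP fS.
apply/andP; split; first (apply/andP; split).
- by apply/injectiveP => x y; rewrite !ffunE => /perm_inj/f_inj.
- by apply/forallP => x; rewrite ffunE tau_cl.
(* If the transported map satisfied [e'], so would [f]: a vertex of [e'] is not in the cherry of
   [e], and if [tau u] moved its image, the new image would be a target shared by [e] and [e']. *)
apply/forall_inP => e' e'S; apply: contra (fS e' e'S) => /eqP pe'.
have := S_free e' e'S; rewrite negb_exists => /forallP disj.
apply/eqP; rewrite -pe'; apply/eq_in_map => x xe'.
rewrite ffunE /=.
have fx_out : f x \notin seq3 e.2.
  rewrite -(eqP ef) (mem_map f_inj); apply/negP => /mem_seq3[i xi].
  have [j xj] := mem_seq3 xe'.
  by have := disj (i, j); rewrite /= xi xj eqxx.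
have := transporter_outside (seq3 (tgt u)) uniq_e2 fx_out.
rewrite -/(tau u) in_cons => /orP[/eqP-> //|/mem_seq3[i fxi]].
have : tau u (f x) \in seq3 e'.2.
  by rewrite -pe'; apply/mapP; exists x; rewrite // ffunE.
move=> /mem_seq3[j fxj]; have := disj (i, j).
by rewrite /= fxi fxj eqxx orbT.
Qed.

(** * Existence of an injection without monochromatic cherries *)

Lemma class_injections_neq0 : class_injections != set0.
Proof.
(* The witness sends each vertex to its rank within its own class. *)
have idx_lt x : index x (enum [set y | cl y == cl x]) < n.
  by apply: leq_trans (card_cl (cl x)); rewrite cardE index_mem mem_enum inE.
apply/set0Pn; exists [ffun x => (cl x, Ordinal (idx_lt x))].
rewrite inE; apply/andP; split; last by apply/forallP => x; rewrite ffunE.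
apply/injectiveP => x y; rewrite !ffunE => -[eq_cl]; rewrite eq_cl => eq_idx.
have [xS yS] : x \in enum [set z | cl z == cl y]
            /\ y \in enum [set z | cl z == cl y].
  by rewrite !mem_enum !inE eq_cl.
by rewrite -(nth_index x xS) eq_idx nth_index.
Qed.

Lemma cherry_avoiding_injection :
    4 <= n -> 48 * (D * D) * K <= n ->
  exists f : G -> H, [/\ injective f, forall x, (f x).1 = cl x &
    forall x y z, adj x y -> adj x z -> y != z ->
      col (f x) (f y) != col (f x) (f z)].
Proof.
move=> n_ge4 K_le.
have conf_le e : e \in oriented_events ->
    4 * #|[set e' in oriented_events | meets e e']| <= n * (n * n.-1).
  move=> _; have := card_meets_oriented e; set k := #|_| => le_k.
  have -> : 4 * k = 2 * (2 * k) by rewrite mulnA.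
  apply: leq_trans (leq_mul (leqnn 2) le_k) _.
  have -> : 2 * (18 * (D * D * (n * (n * K)))) = n * (n * (36 * (D * D) * K)).
    by lia.
  (* Here [36 * D^2 * K] is at most three quarters of [n], hence at most [n - 1] because
     [4 <= n]. *)
  rewrite !leq_mul //; lia.
have N_gt2 : 2 < n * (n * n.-1) by nia.
have /set0Pn[f] := lopsided_local_lemma transport_bound conf_le N_gt2
  class_injections_neq0.
rewrite !inE.
case/andP => /andP[/injectiveP f_inj /forallP f_cl] /forall_inP f_avoid.
have f_clE x : (f x).1 = cl x by apply/eqP.
(* Avoided events list the leaves in increasing rank; the other order follows by symmetry of the
   inequality. *)
have main x y z : enum_rank y < enum_rank z -> adj x y -> adj x z -> y != z ->
    col (f x) (f y) != col (f x) (f z).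
  move=> lt_yz xy xz yz; apply/negP => eq_col.
  have /f_avoid : ((x, y, z), (f x, f y, f z)) \in oriented_events.
    rewrite !inE /cherry /bad_target /= lt_yz xy xz yz eq_col !f_clE !eqxx.
    by rewrite (inj_eq f_inj) yz.
  by rewrite /event_holds eqxx.
exists f; split=> // x y z xy xz yz.
have [lt_yz|lt_zy|/val_inj/enum_rank_inj eq_yz] :=
  ltngtP (enum_rank y) (enum_rank z).
- exact: main.
- by rewrite eq_sym; apply: main; rewrite // eq_sym.
- by rewrite eq_yz eqxx in yz.
Qed.

End CherryAvoidance.

(** * Properly colored copies *)

Lemma set2_inj (T : finType) (a b b' : T) : [set a; b] = [set a; b'] -> b = b'.
Proof.
move=> E; have := set22 a b; rewrite {1}E !inE => /orP[/eqP ba|/eqP //].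
by have := set22 a b'; rewrite -E ba !inE orbb => /eqP.
Qed.

(** The copy consists of the images of the edges of [G] only, since [H] may have further edges
    between image vertices. *)
Lemma proper_for_embedding (G H : sgraph) (c : coloring H) (f : G -> H) :
    injective f -> (forall x y, adj x y -> adj (f x) (f y)) ->
    (forall x y z, adj x y -> adj x z -> y != z ->
      c [set f x; f y] != c [set f x; f z]) ->
  proper_for G c.
Proof.
move=> f_inj f_adj f_col.
pose E := [set e : {set H} |
  [exists x : G, exists y : G, adj x y && (e == [set f x; f y])]].
have E_edges : E \subset edges H.
  apply/subsetP => e; rewrite !inE => /existsP[x /existsP[y /andP[xy e_xy]]].
  by apply/existsP; exists (f x); apply/existsP; exists (f y); rewrite f_adj.
have E_ends e : e \in E -> e \subset f @: [set: G].
  rewrite inE => /existsP[x /existsP[y /andP[_ /eqP->]]].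
  by apply/subsetP => v; rewrite !inE => /orP[]/eqP->; apply/imset_f.
(* Writing an edge with a chosen endpoint first turns two incident edges into the image of a cherry
   centered at the common vertex. *)
have incident e v : e \in E -> v \in e ->
    exists x y, [/\ v = f x, adj x y & e = [set f x; f y]].
  rewrite inE => /existsP[x /existsP[y /andP[xy /eqP->]]].
  rewrite !inE => /orP[]/eqP->; first by exists x, y.
  by exists y, x; rewrite adj_sym setUC.
exists (Subgraph E_edges E_ends); split.
  exists f; split=> // x y /=; apply/idP/idP => [xy|].
    rewrite inE; apply/existsP; exists x; apply/existsP; exists y.
    by rewrite xy /=.
  move=> /incident /(_ (set21 _ _))[x' [y' [/f_inj <- xy' E_xy]]].
  by rewrite (f_inj _ _ (set2_inj E_xy)).
move=> e1 e2 /= e1E e2E e12 /set0Pn[v]; rewrite inE => /andP[ve1 ve2].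
have [x [y [vx xy def1]]] := incident e1 v e1E ve1; rewrite vx in ve2.
have [x' [z [/f_inj <- xz def2]]] := incident e2 _ e2E ve2.
apply/eqP; rewrite def1 def2; apply: f_col => //.
by apply: contraNneq e12 => yz; rewrite def1 def2 yz.
Qed.

Lemma max_degree_edge (G : sgraph) :
  0 < max_degree G -> exists x y : G, adj x y.
Proof.
move=> D_gt0; have [/existsP[x /existsP[y xy]]|no_edge] :=
  boolP [exists x : G, exists y : G, adj x y]; first by exists x, y.
suff : max_degree G <= 0 by rewrite leqNgt D_gt0.
apply/bigmax_leqP => x _; rewrite leqn0 cards_eq0; apply/eqP/setP => y.
rewrite !inE; apply: contraNF no_edge => xy.
by apply/existsP; exists x; apply/existsP; exists y.
Qed.

(** A cardinality is an integer, so the bound n/d may be replaced by its floor. *)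
Lemma locally_bounded_nat (R : realFieldType) (n d : nat) (H : sgraph)
    (c : coloring H) (v : H) (a : nat) :
    0 < d -> locally_bounded (n%:R / d%:R : R)%R c ->
  #|[set e in edges H | (v \in e) && (c e == a)]| <= n %/ d.
Proof.
move=> d_gt0 /(_ v a); rewrite leq_divRL //.
rewrite Num.Theory.ler_pdivlMr ?Num.Theory.ltr0n //.
by rewrite -GRing.natrM Num.Theory.ler_nat.
Qed.

Theorem theorem1p5 (R : realFieldType) (m n : nat) (G : sgraph)
    (U : 'I_m -> {set G}) (c : coloring (complete_multipartite m n))
    (hm : 2 <= m) (hn : 1 <= n) (hDelta : 1 <= max_degree G)
    (hU : partition_family U)
    (hind : forall i : 'I_m, independent (U i))
    (hcard : forall i : 'I_m, #|U i| <= n)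
    (hc : locally_bounded
            ((n%:R / (48%:R * (max_degree G)%:R ^+ 2))%R : R) c) :
  proper_for G c.
Proof.
set D := max_degree G in hDelta hc *.
have /fin_all_exists[cl clU] : forall x : G, exists i : 'I_m, x \in U i.
  move=> x; have : x \in \bigcup_(i < m) U i by rewrite hU.1 inE.
  by case/bigcupP => i _; exists i.
have adj_cl (x y : G) : adj x y -> cl x != cl y.
  move=> xy; apply/eqP => eq_cl; have := clU y; rewrite -eq_cl.
  by move=> /(hind _ _ _ (clU x)); rewrite xy.
have card_cl i : #|[set x | cl x == i]| <= n.
  apply: leq_trans (hcard i); apply/subset_leq_card/subsetP => x.
  by rewrite inE => /eqP <-.
have degree_le (x : G) : degree x <= D by apply: leq_bigmax.
have DD_gt0 : 0 < 48 * (D * D) by rewrite !muln_gt0 hDelta.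
have {}hc (v : complete_multipartite m n) (a : nat) :
    #|[set e in edges (complete_multipartite m n) | (v \in e) && (c e == a)]|
      <= n %/ (48 * (D * D)).
  apply: (@locally_bounded_nat R) => //.
  by rewrite !GRing.natrM -GRing.expr2.
set K := n %/ (48 * (D * D)) in hc.
have edge_in (a b : complete_multipartite m n) :
    a.1 != b.1 -> [set a; b] \in edges (complete_multipartite m n).
  move=> ab; rewrite inE; apply/existsP; exists a; apply/existsP; exists b.
  by rewrite eqxx andbT.
have col_le (a b : complete_multipartite m n) :
    #|[set b' : 'I_m * 'I_n |
        (b'.1 != a.1) && (c [set a; b'] == c [set a; b])]| <= K.
  apply: leq_trans (hc a (c [set a; b])).
  apply: (leq_card_inj (g := fun b' => [set a; b'])) => [b1 b2 _ _|b'].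
    exact: set2_inj.
  rewrite inE => /andP[b'a eq_c].
  by rewrite inE set21 eq_c edge_in // eq_sym.
have K_le : 48 * (D * D) * K <= n by rewrite mulnC leq_divM.
(* An edge of [G] joins two different classes, so the host has an edge as well. Its color occurs at
   its endpoint, which forces [K >= 1] and thus [n >= 48]. *)
have n_ge4 : 4 <= n.
  have [x [y xy]] := max_degree_edge hDelta.
  pose a : complete_multipartite m n := (cl x, Ordinal hn).
  pose b : complete_multipartite m n := (cl y, Ordinal hn).
  have K_gt0 : 0 < K.
    apply: leq_trans (hc a (c [set a; b])).
    apply/card_gt0P; exists [set a; b].
    by rewrite inE set21 eqxx edge_in //= adj_cl.
  by apply: leq_trans K_le; nia.
have [f [f_inj f_cl f_col]] :=
  @cherry_avoiding_injection m n D K G cl (fun a b => c [set a; b])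
    adj_cl card_cl degree_le col_le n_ge4 K_le.
apply: (@proper_for_embedding _ (complete_multipartite m n) c f) => // x y xy.
by rewrite /adj /= /multipartite_adj !f_cl adj_cl.
Qed.
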